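(* Let $G$ be a finite group, $p$ a prime, $P$ a Sylow $p$-subgroup of $G$, and let $H\le G$ be a subgroup containing $N_G(P)$. Set $\mathcal S=\mathcal S(G,P,H)$. Then (i) $\operatorname{Ind}_H^G(\mathcal I(H,P,\mathcal S))\subseteq \mathcal I(G,P,\mathcal S)$; (ii) $\operatorname{Res}_H^G(\mathcal I(G,P,\mathcal S))\subseteq \mathcal I(H,P,\mathcal S)$; (iii) the maps $\operatorname{Res}^G_H$ and $\operatorname{Ind}^G_H$ yield mutually inverse isomorphisms between the abelian groups $\mathcal C(G)/\mathcal I(G,P,\mathcal S)$ and $\mathcal C(H)/\mathcal I(H,P,\mathcal S)$.
   Context: For a finite group $X$, $\operatorname{Irr}(X)$ is the set of complex irreducible characters and $\mathcal C(X)=\mathbb Z\operatorname{Irr}(X)$ is the abelian group of virtual characters of $X$. Write ${}^tP=tPt^{-1}$. For a $p$-subgroup $P$ of $G$ and a subgroup $H\le G$, the intersection set is $\mathcal S(G,P,H)=\{Q\le P \mid Q\subseteq {}^tP \text{ for some } t\in G\setminus H\}$. If $\mathcal S$ is a family of subgroups of $P$ closed under taking subgroups, and $X$ is a finite group having $P$ as a subgroup, then $\mathcal I(X,P,\mathcal S)$ is the subgroup of $\mathcal C(X)$ spanned by all $\operatorname{Ind}_L^X\phi$ where $\phi\in\mathcal C(L)$ and $L\le X$ is a subgroup such that $L\cap P$ is a Sylow $p$-subgroup of $L$ and $L\cap P\in\mathcal S$. *)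

(* Defs.v *)
From HB Require Import structures.
From mathcomp Require Import all_boot all_order all_algebra.
From mathcomp Require Import all_fingroup all_solvable all_field all_character.
From mathcomp Require Import generic_quotient ring_quotient.
From mathcomp Require Import boolp.

Set Implicit Arguments.
Unset Strict Implicit.
Unset Printing Implicit Defensive.

Import GroupScope GRing.Theory.
Local Open Scope ring_scope.

(* The abelian group Z Irr(X) of virtual characters, as a type of its own so
   that it can be quotiented; complex characters are taken over algC, as
   everywhere in MathComp. *)
Record vchar (gT : finGroupType) (X : {group gT}) : predArgType := VChar {
  vchar_val :> 'CF(X);
  vchar_valP : vchar_val \in 'Z[irr X]
}.

HB.instance Definition _ (gT : finGroupType) (X : {group gT}) :=
  [isSub for @vchar_val gT X].
HB.instance Definition _ (gT : finGroupType) (X : {group gT}) :=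
  [Choice of vchar X by <:].
HB.instance Definition _ (gT : finGroupType) (X : {group gT}) :=
  [SubChoice_isSubZmodule of vchar X by <:].

Definition vInd (gT : finGroupType) (X L : {group gT}) (phi : vchar L) :
    vchar X :=
  VChar (cfInd_vchar X (vchar_valP phi)).

Definition vRes (gT : finGroupType) (X L : {group gT}) (phi : vchar X) :
    vchar L :=
  VChar (cfRes_vchar L (vchar_valP phi)).

Arguments vInd {gT} X {L} phi.
Arguments vRes {gT X} L phi.

(* P :^ t^-1 is t P t^-1, because P :^ x = x^-1 P x in MathComp. *)
Definition intersection_set (gT : finGroupType) (G P H : {group gT}) :
    {set {group gT}} :=
  [set Q : {group gT} |
    (Q \subset P) && [exists t in G :\: H, Q \subset P :^ t^-1]].

Lemma intersection_setS (gT : finGroupType) (G P H Q R : {group gT}) :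
  R \subset Q -> Q \in intersection_set G P H -> R \in intersection_set G P H.
Proof.
move=> sRQ; rewrite !inE => /andP[sQP /exists_inP[t Gt sQPt]].
rewrite (subset_trans sRQ sQP); apply/exists_inP; exists t => //.
exact: subset_trans sRQ sQPt.
Qed.

(* The subgroup of V spanned by A: all integral combinations of finite
   sequences of elements of A. *)
Definition zspan (V : zmodType) (A : V -> Prop) : {pred V} :=
  fun v => `[< exists s : seq V,
    (forall a, a \in s -> A a) /\ inIntSpan (in_tuple s) v >].

Fact zspan_zmod_closed (V : zmodType) (A : V -> Prop) : zmod_closed (zspan A).
Proof.
split; first by apply/asboolP; exists [::]; split=> //; exists 0; rewrite big_ord0.
move=> u v /asboolP[s [As [a Du]]] /asboolP[t [At [b Dv]]].
apply/asboolP; exists (s ++ t); split.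
  by move=> x; rewrite mem_cat => /orP[/As | /At].
pose c (i : nat) : int :=
  if (i < size s)%N then oapp a 0 (insub i) else - oapp b 0 (insub (i - size s)%N).
exists [ffun i : 'I_(size (s ++ t)) => c i].
under eq_bigr => i _ do rewrite ffunE.
rewrite -(big_mkord xpredT (fun i => (s ++ t)`_i *~ c i)) size_cat.
rewrite (big_cat_nat (n := size s)) ?leq_addr //=.
rewrite -{2}[size s]add0n big_addn addnC addnK !big_mkord Du Dv -sumrN.
congr (_ + _); apply: eq_bigr => i _.
  by rewrite nth_cat /c ltn_ord valK.
rewrite nth_cat /c ltnNge leq_addl /= addnK valK /=.
by rewrite mulrNz.
Qed.

HB.instance Definition _ (V : zmodType) (A : V -> Prop) :=
  GRing.isZmodClosed.Build V (zspan A) (zspan_zmod_closed A).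

Definition induced_from (gT : finGroupType) (p : nat) (X P : {group gT})
    (S : {set {group gT}}) (theta : vchar X) : Prop :=
  exists (L : {group gT}) (phi : vchar L),
    [/\ L \subset X, p.-Sylow(L) (L :&: P), (L :&: P)%G \in S
      & theta = vInd X phi].

(* I(X, P, S); p is a parameter because "Sylow" refers to it.  The definition
   makes sense for any S, but is only meant for families closed under taking
   subgroups, such as intersection_set G P H (lemma intersection_setS). *)
Definition calI (gT : finGroupType) (p : nat) (X P : {group gT})
    (S : {set {group gT}}) : zmodClosed (vchar X) :=
  zspan (@induced_from gT p X P S).

(* Main.v *)
From HB Require Import structures.
Require Import Defs.
From mathcomp Require Import all_boot all_order all_algebra.
From mathcomp Require Import all_fingroup all_solvable all_field all_character.
From mathcomp Require Import generic_quotient ring_quotient boolp.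

Set Implicit Arguments.
Unset Strict Implicit.
Unset Printing Implicit Defensive.

Import GroupScope GRing.Theory Num.Theory.
Local Open Scope ring_scope.
Local Open Scope quotient_scope.

(** Inclusion (i) is transitivity of induction.  Inclusion (ii) and the
    congruence of Res (Ind psi) with psi come from Mackey's formula.  The
    double coset H g L contributes a character induced to H from
    H :&: g L g^-1; for a suitable representative g, a Sylow p-subgroup Q of
    that intersection lies in P and in some y P y^-1.  If y can be taken
    outside H, then Q is in S; this is so for every nontrivial double coset when
    L = H, and for every double coset when L :&: P is already in S
    (dcoset_in_calI).  For L = H the trivial double coset contributes psi
    itself.

    The remaining congruence, of Ind (Res phi) with phi, follows once every
    virtual character of G is known to be induced from H modulo I(G, P, S).
    This holds for characters induced from a p-closed subgroup L, that is, one
    with a normal Sylow p-subgroup Q, which may be taken in P: either Q is in S,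
    or the normaliser of Q, hence L, lies in H (pclosed_vInd_mod_calI).

    It remains to see that characters induced from p-closed subgroups span all
    virtual characters (vchar_pclosed_span), a weak form of Brauer's induction
    theorem.  The span is an ideal, so it is enough to find 1 in it, and for this
    to find, for every x in G and every prime q, a member with integral
    value at x prime to q (exists_value1, one_mem_of_value1).  Solomon's
    choice is the permutation character on G / E, where C is generated by the
    q'-part of x and E is the product of C and a Sylow q-subgroup of 'N_G(C)
    (quasi_elementary_fix_mod).  If q differs from p, then E is p-closed.  If
    q = p, Clifford theory shows that 1 on E is itself a combination of
    characters induced from p-closed subgroups (quasi_pclosed_span1). *)

(** * Spans and quotients *)

Lemma zspan_gen (V : zmodType) (A : V -> Prop) a : A a -> a \in zspan A.
Proof.
move=> Aa; apply/asboolP; exists [:: a]; split.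
  by move=> x; rewrite inE => /eqP->.
by exists [ffun=> 1]; rewrite big_ord1 ffunE.
Qed.

Lemma zspan_ind (V : zmodType) (A K : V -> Prop) :
    K 0 -> (forall u v, K u -> K v -> K (u - v)) -> (forall a, A a -> K a) ->
  forall v, v \in zspan A -> K v.
Proof.
move=> K0 KB KA v /asboolP[s [As [a ->]]].
have KN u : K u -> K (- u) by rewrite -[- u]add0r; apply: KB.
have KD u w : K u -> K w -> K (u + w).
  by move=> Ku Kw; rewrite -[w]opprK; apply: KB => //; apply: KN.
apply: big_ind => // i _; have Ks: K s`_i by apply/KA/As/mem_nth.
have Kn n : K (s`_i *+ n) by elim: n => // n IHn; rewrite mulrS; apply: KD.
by case: (a i) => n; [apply: Kn | apply/KN/Kn].
Qed.

Lemma quot_additive_lift (V W : zmodType) (I : zmodClosed V) (J : zmodClosed W)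
    (f : V -> W) :
    zmod_morphism f -> (forall v, v \in I -> f v \in J) ->
  exists F : {additive {ideal_quot I} -> {ideal_quot J}},
    forall v, F (\pi_{ideal_quot I} v) = \pi_{ideal_quot J} (f v).
Proof.
move=> fB fIJ; pose F (u : {ideal_quot I}) := \pi_{ideal_quot J} (f (repr u)).
have Fpi v : F (\pi_{ideal_quot I} v) = \pi_{ideal_quot J} (f v).
  apply/eqP; rewrite /F -Quotient.idealrBE -fB; apply: fIJ.
  by rewrite Quotient.idealrBE reprK.
have FB : zmod_morphism F.
  by move=> u v; rewrite -[u]reprK -[v]reprK -raddfB !Fpi fB raddfB.
pose F_additive := GRing.isZmodMorphism.Build _ _ F FB.
pose FA : {additive {ideal_quot I} -> {ideal_quot J}} := HB.pack F F_additive.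
by exists FA.
Qed.

(** * Conjugation and Mackey's formula for virtual characters *)

Section VirtualCharacters.

Variable gT : finGroupType.
Implicit Types (G H L : {group gT}).

Lemma vRes_zmod_morphism G H : zmod_morphism (@vRes gT G H).
Proof. by move=> u v; apply: val_inj; rewrite /= raddfB. Qed.

Lemma vInd_zmod_morphism G H : zmod_morphism (@vInd gT G H).
Proof. by move=> u v; apply: val_inj; rewrite /= raddfB. Qed.

HB.instance Definition _ G H :=
  GRing.isZmodMorphism.Build _ _ _ (@vRes_zmod_morphism G H).
HB.instance Definition _ G H :=
  GRing.isZmodMorphism.Build _ _ _ (@vInd_zmod_morphism G H).

Lemma vIndInd G H L (phi : vchar L) :
  H \subset G -> L \subset H -> vInd G (vInd H phi) = vInd G phi.
Proof. by move=> sHG sLH; apply: val_inj; apply: cfIndInd. Qed.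

(** Transport of class functions from L to its conjugate g L g^-1.  The detour
    by an isomorphism, rather than conjugation inside a fixed group, is needed
    since g need not normalise L. *)
Definition cfConjIsom L (g : gT) (phi : 'CF(L)) : 'CF(L :^ g^-1) :=
  cfIsom (conj_isom L g^-1) phi.

Lemma cfConjIsomE L g (phi : 'CF(L)) x : cfConjIsom g phi x = phi (x ^ g)%g.
Proof.
have [Lx | L'x] := boolP (x ^ g \in L)%g.
  by rewrite -{1}[x](conjgK g) cfIsomE.
by rewrite !cfun0 // mem_conjg invgK.
Qed.

Lemma cfConjIsom_vchar L g (phi : 'CF(L)) :
  phi \in 'Z[irr L] -> cfConjIsom g phi \in 'Z[irr (L :^ g^-1)].
Proof.
case/vcharP=> chi1 Nchi1 [chi2 Nchi2 ->].
by rewrite /cfConjIsom raddfB rpredB ?char_vchar ?cfIsom_char.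
Qed.

Definition vConj L g (phi : vchar L) : vchar (L :^ g^-1) :=
  VChar (cfConjIsom_vchar g (vchar_valP phi)).

(** Inducing from a conjugate subgroup makes no difference, which is what
    allows a subgroup of G to be moved so that its Sylow subgroup lies in P. *)
Lemma vInd_vConj G L g (phi : vchar L) :
  L \subset G -> g \in G -> vInd G (vConj g phi) = vInd G phi.
Proof.
move=> sLG Gg; apply: val_inj; apply/cfun_inP=> x Gx /=.
have sLgG : L :^ g^-1 \subset G by rewrite -(conjGid (groupVr Gg)) conjSg.
rewrite !cfIndE // cardJg; congr (_ * _).
rewrite (reindex_acts 'R _ (groupVr Gg)) ?astabsR //=.
by apply: eq_bigr => y _; rewrite cfConjIsomE -conjgM mulgKV.
Qed.

Definition dcoset H L (g : gT) : {set gT} := (H :* g * L)%g.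

Lemma dcosetP H L g y :
  reflect (exists2 h, h \in H & exists2 l, l \in L & y = (h * g * l)%g)
          (y \in dcoset H L g).
Proof.
apply: (iffP mulsgP) => [[_ l /rcosetP[h Hh ->] Ll ->] | [h Hh [l Ll ->]]].
  by exists h => //; exists l.
by exists (h * g)%g l; rewrite ?mem_rcoset ?mulgK.
Qed.

Lemma dcoset_refl H L g : g \in dcoset H L g.
Proof. by apply/dcosetP; exists 1%g => //; exists 1%g; rewrite ?mulg1 ?mul1g. Qed.

Lemma dcoset_eqP H L g y :
  reflect (dcoset H L y = dcoset H L g) (y \in dcoset H L g).
Proof.
apply: (iffP idP) => [/dcosetP[h Hh [l Ll ->]] | <-]; last exact: dcoset_refl.
by rewrite /dcoset !rcosetM (rcoset_id Hh) -mulgA (lcoset_id Ll).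
Qed.

(** Both sides count pairs (h, y) with h in H and y in h g L.  For a fixed y
    in H g L the admissible h form a left coset of H :&: g L g^-1; for a fixed
    h the admissible y form the left coset h g L, on which F is constant. *)
Lemma sum_dcoset (V : zmodType) H L g (F : gT -> V) :
    (forall y l : gT, l \in L -> F (y * l)%g = F y) ->
  (\sum_(y in dcoset H L g) F y) *+ #|(H :&: L :^ g^-1)%g|
    = (\sum_(h in H) F (h * g)%g) *+ #|L|.
Proof.
move=> FL; rewrite -!sumrMnl.
transitivity (\sum_(y in dcoset H L g) \sum_(h in H | y \in ((h * g) *: L)%g) F y).
  apply: eq_bigr => _ /dcosetP[h0 Hh0 [l0 Ll0 ->]].
  rewrite sumr_const; congr (_ *+ _).
  rewrite -(card_lcoset _ h0); apply: eq_card => h.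
  rewrite mem_lcoset in_setI [RHS]unfold_in /= groupMl ?groupV // mem_conjgV.
  congr (_ && _); rewrite -groupV conjgE mem_lcoset !invMg !invgK !mulgA.
  by rewrite (groupMr _ Ll0).
rewrite (exchange_big_dep (mem H)) /=; last by move=> y h _ /andP[].
apply: eq_bigr => h Hh.
rewrite -(card_lcoset _ (h * g)%g) -sumr_const; apply: eq_big => [y | y].
  rewrite Hh /=; case: lcosetP; rewrite ?andbF // => -[l Ll ->].
  by rewrite andbT; apply/dcosetP; exists h => //; exists l.
by case/and3P=> _ _ /lcosetP[l Ll ->]; rewrite FL.
Qed.

Lemma dcoset_sub G H L g :
  H \subset G -> L \subset G -> g \in G -> dcoset H L g \subset G.
Proof.
move=> /subsetP sHG /subsetP sLG Gg; apply/subsetP=> y /dcosetP[h /sHG Gh].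
by case=> l /sLG Gl ->{y}; rewrite !groupM.
Qed.

(** The representatives r are left free: a good choice of r D in each double
    coset D places the Sylow subgroup of H :&: (r D) L (r D)^-1 inside P. *)
Lemma cfMackey G H L (phi : 'CF(L)) (r : {set gT} -> gT) :
    H \subset G -> L \subset G ->
    {in dcoset H L @: G, forall D : {set gT}, r D \in D} ->
  'Res[H] ('Ind[G] phi) =
    \sum_(D in dcoset H L @: G)
       'Ind[H] ('Res[(H :&: L :^ (r D)^-1)%G] (cfConjIsom (r D) phi)).
Proof.
move=> sHG sLG Dr; apply/cfun_inP=> x Hx.
rewrite cfResE // cfIndE // sum_cfunE (partition_big_imset (dcoset H L)) /=.
rewrite mulr_sumr; apply: eq_bigr => _ /imsetP[g Gg ->].
have: r (dcoset H L g) \in dcoset H L g by apply/Dr/imset_f.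
move: (r _) => g' /dcoset_eqP Dg'; rewrite cfIndE ?subsetIl //=.
rewrite (eq_bigl (mem (dcoset H L g'))) => [|y]; last first.
  rewrite Dg' /=; apply/andP/idP => [[_ /eqP/dcoset_eqP] // | Dy].
  split; last exact/eqP/dcoset_eqP.
  by apply: subsetP Dy; rewrite dcoset_sub.
apply: (mulfI (neq0CG L)); rewrite mulVKf ?neq0CG //.
apply: (mulIf (neq0CG (H :&: L :^ g'^-1)%G)).
rewrite mulr_natr sum_dcoset => [|y l Ll]; last by rewrite conjgM cfunJ.
rewrite -[LHS]mulr_natl -!mulrA; congr (_ * _); rewrite mulrC mulfK ?neq0CG //.
apply: eq_bigr => h Hh; rewrite conjgM.
have [Mx | M'x] := boolP ((x ^ h)%g \in (H :&: L :^ g'^-1)%G).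
  by rewrite cfResE ?subsetIr // cfConjIsomE.
rewrite [RHS]cfun0 // cfun0 //; apply: contra M'x => Lx.
by rewrite inE groupJ //= mem_conjgV.
Qed.

Definition vMackey H L (phi : vchar L) g : vchar H :=
  vInd H (vRes (H :&: L :^ g^-1)%G (vConj g phi)).

Lemma vchar_val_sum (G : {group gT}) I (r : seq I) (P : pred I) (F : I -> vchar G) :
  vchar_val (\sum_(i <- r | P i) F i) = \sum_(i <- r | P i) vchar_val (F i).
Proof. exact: (raddf_sum (\val : vchar G -> 'CF(G))). Qed.

Lemma vMackeyE G H L (phi : vchar L) (r : {set gT} -> gT) :
    H \subset G -> L \subset G ->
    {in dcoset H L @: G, forall D : {set gT}, r D \in D} ->
  vRes H (vInd G phi) = \sum_(D in dcoset H L @: G) vMackey H phi (r D).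
Proof. by move=> sHG sLG Dr; apply: val_inj; rewrite /= vchar_val_sum; apply: cfMackey. Qed.

Lemma vMackey1 H (phi : vchar H) : vMackey H phi 1%g = phi.
Proof.
apply: val_inj; apply/cfun_inP=> x Hx /=.
have defM: H :&: H :^ 1^-1 = H by rewrite invg1 conjsg1 setIid.
rewrite cfIndE ?subsetIl //= [#|_|](congr1 (fun A : {set gT} => #|A|) defM).
apply: canLR (mulKf (neq0CG H)) _; rewrite mulr_natl -sumr_const.
apply: eq_bigr => h Hh; rewrite cfResE ?subsetIr ?cfConjIsomE ?conjg1 ?cfunJ //=.
by rewrite defM groupJ.
Qed.

End VirtualCharacters.

(** * Induction from p-closed subgroups *)

(** The condition on 'O_p(E) says that E is p-closed, that is, has a normal
    Sylow p-subgroup. *)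
Definition induced_from_pclosed (gT : finGroupType) (p : nat) (G : {group gT})
    (theta : 'CF(G)) : Prop :=
  exists (E : {group gT}) (phi : 'CF(E)),
    [/\ E \subset G, p.-Sylow(E) 'O_p(E), phi \in 'Z[irr E] & theta = 'Ind phi].

Section Brauer.

Variables (gT : finGroupType) (p : nat).
Implicit Types (G H E C R : {group gT}).

Local Notation J G := (zspan (@induced_from_pclosed gT p G)).

Lemma pclosed_span_vchar G f : f \in J G -> f \in 'Z[irr G].
Proof.
move: f; apply: zspan_ind => [|u v|_ [E [phi [_ _ Zphi ->]]]].
  exact: rpred0.
  exact: rpredB.
exact: cfInd_vchar.
Qed.

(** The projection formula makes the span an ideal of the character ring, so
    that it is everything as soon as it contains 1. *)
Lemma pclosed_span_mul G f chi :
  f \in J G -> chi \in 'Z[irr G] -> f * chi \in J G.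
Proof.
move=> + Zchi; move: f; apply: zspan_ind => [|u v Ju Jv|_ [E [phi [sEG pE Zphi ->]]]].
- by rewrite mul0r rpred0.
- by rewrite mulrBl rpredB.
rewrite -cfIndM //; apply: zspan_gen; exists E, (phi * 'Res[E] chi).
by split=> //; apply: rpredM => //; apply: cfRes_vchar.
Qed.

Lemma pclosed_span_ind G H f : H \subset G -> f \in J H -> 'Ind[G] f \in J G.
Proof.
move=> sHG; move: f; apply: zspan_ind => [|u v Ju Jv|_ [E [phi [sEH pE Zphi ->]]]].
- by rewrite raddf0 rpred0.
- by rewrite raddfB rpredB.
rewrite cfIndInd //; apply: zspan_gen; exists E, phi.
by split=> //; apply: subset_trans sHG.
Qed.

Lemma pclosed_span_full G :
  1 \in J G -> forall chi, chi \in 'Z[irr G] -> chi \in J G.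
Proof. by move=> J1 chi Zchi; rewrite -[chi]mul1r; apply: pclosed_span_mul. Qed.

Lemma pclosed_span_Ind1 G E :
  E \subset G -> p.-Sylow(E) 'O_p(E) -> 'Ind[G, E] 1 \in J G.
Proof. by move=> sEG pE; apply: zspan_gen; exists E, 1; rewrite cfun1_vchar. Qed.

(** Invariance puts [~: C, R] in the kernel K of lambda, so R acts trivially on
    C / K.  By coprime action the centraliser of R in C / K is the image of
    'C_C(R), which is trivial. *)
Lemma invariant_lin_char_eq1 C R (lambda : 'CF(C)) :
    R \subset 'N(C) -> coprime #|C| #|R| -> abelian C ->
    lambda \is a linear_char -> R \subset 'I[lambda] ->
    'C_C(R) \subset cfker lambda ->
  lambda = 1.
Proof.
move=> nCR coCR cCC lin_la IRla sZK.
have sCK: C \subset cfker lambda.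
  have sCRK : [~: C, R] \subset cfker lambda.
    rewrite gen_subG; apply/subsetP=> _ /imset2P[x r Cx Rr ->].
    have Cxr: (x ^ r)%g \in C by rewrite memJ_norm ?(subsetP nCR).
    rewrite /= cfkerEchar ?lin_charW // inE groupM ?groupV //= commgEl.
    rewrite lin_charM ?groupV // (inertia_valJ _ (subsetP IRla r Rr)).
    by rewrite -lin_charM ?groupV // mulVg.
  have nKR : R \subset 'N(cfker lambda).
    by rewrite -commg_subl (subset_trans (commSg _ (cfker_sub _))).
  have nKC : C \subset 'N(cfker lambda) := cfker_norm lambda.
  rewrite -quotient_sub1 // -(setIidPl (quotient_cents2r sCRK)).
  rewrite -(coprime_quotient_cent (cfker_sub _)) ?abelian_sol //.
  by rewrite quotient_sub1 // subIset ?nKC.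
apply/cfun_inP=> x Cx; rewrite cfun1E Cx /=.
by rewrite (cfker1 (subsetP sCK x Cx)) lin_char1.
Qed.

(** The key point of the Clifford argument: among the constituents of
    'Ind[E, K] 1 only the principal character lies over an E-invariant character
    of C.  By Frobenius reciprocity the restriction of 'chi_i to K contains 1,
    hence so do its restrictions to 'C_C(R) and to R.  The former forces 'chi_j
    to be trivial by invariant_lin_char_eq1, so 'chi_i factors through E / C, which
    is R; the latter then forces 'chi_i = 1. *)
Lemma invariant_constt_cent_eq0 E C R (K : {group gT}) (i : Iirr E) (j : Iirr C) :
    C ><| R = E -> abelian C -> coprime #|C| #|R| ->
    K \subset E -> 'C_C(R) \subset K -> R \subset K ->
    i \in irr_constt ('Ind[E, K] 1) -> j \in irr_constt ('Res[C] 'chi_i) ->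
    E \subset 'I['chi_j] ->
  i = 0.
Proof.
move=> defE cCC coCR sKE sZK sRK; rewrite -irr0 constt_Ind_Res => Ki Cj IEj.
have [nsCE sRE _ nCR _] := sdprod_context defE; have sCE := normal_sub nsCE.
have lin_j : 'chi_j \is a linear_char by apply/char_abelianP.
have defCi := Clifford_Res_sum_cfclass nsCE Cj.
rewrite cfclass_invariant // big_seq1 in defCi.
have constt1 (L : {group gT}) : L \subset K -> 0 \in irr_constt ('Res[L] 'chi_i).
  move=> sLK; rewrite -(cfResRes _ sLK sKE).
  apply: (constt_Res_trans _ Ki); first by rewrite cfRes_char ?irr_char.
  by rewrite irr0 cfRes_cfun1 ?irr_consttE irr0 ?cfnorm1 ?oner_eq0.
have{constt1} [Z1 R1] := (constt1 'C_C(R)%G sZK, constt1 R sRK).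
have lam1 : 'chi_j = 1.
  apply: (invariant_lin_char_eq1 nCR coCR cCC lin_j).
    exact: subset_trans sRE IEj.
  have sZC : 'C_C(R) \subset C := subsetIl _ _.
  have: 'Res['C_C(R)] 'chi_j = 1.
    have /irrP[k Dk] : 'Res['C_C(R)%G] 'chi_j \in irr 'C_C(R).
      exact: lin_char_irr (cfRes_lin_char _ lin_j).
    rewrite -(cfResRes _ sZC sCE) defCi linearZ /= Dk irr_consttE cfdotZl in Z1.
    rewrite cfdot_irr in Z1; rewrite Dk; case: (k =P 0) Z1 => [-> _ | _].
      by rewrite irr0.
    by rewrite mulr0 eqxx.
  move=> res1; apply/subsetP=> z Zz; have Cz := subsetP sZC z Zz.
  rewrite cfkerEchar ?lin_charW // inE Cz lin_char1 //=.
  by rewrite -(cfResE _ sZC Zz) res1 cfun1E Zz.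
have j0 : j = 0 by apply: irr_inj; rewrite irr0.
have /(cfRes_sdprodK defE) Di : C \subset cfker 'chi_i.
  by apply: constt0_Res_cfker nsCE _; rewrite -j0.
apply/eqP; have: '['chi_i, 'chi_0] != 0.
  rewrite irr0 -(rmorph1 (cfSdprod defE)) -Di cfSdprod_iso -irr0.
  by rewrite -irr_consttE.
by rewrite cfdot_irr; case: (i == 0); rewrite ?eqxx.
Qed.

(** Induction on the order of E.  The group K = 'C_C(R) <*> R is p-closed, and
    'Ind[E, K] 1 is 1 plus nonprincipal irreducible characters.  Each of these
    lies over a non-invariant character of C, so it is induced from a proper
    inertia subgroup containing C, which has the same structure as E. *)
Lemma quasi_pclosed_span1 E C R :
  C ><| R = E -> abelian C -> p^'.-group C -> p.-group R -> 1 \in J E.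
Proof.
have [n] := ubnP #|E|; elim: n E R => // n IHn E R leEn defE cCC p'C pR.
have [nsCE sRE mulCR nCR tiCR] := sdprod_context defE.
have [sCE _] := andP nsCE.
have coCR : coprime #|C| #|R| by rewrite coprime_sym (pnat_coprime pR).
pose K := ('C_C(R) <*> R)%G.
have sZK : 'C_C(R) \subset K := joing_subl _ _.
have sRK : R \subset K := joing_subr _ _.
have sKE : K \subset E by rewrite join_subG sRE subIset ?sCE.
have pK : p.-Sylow(K) 'O_p(K).
  have nsRK : R <| K.
    by rewrite /normal sRK join_subG normG cents_norm ?subsetIr.
  have sylR : p.-Sylow(E) R.
    by rewrite /pHall sRE pR -divgS // -(sdprod_card defE) mulnK ?cardG_gt0.
  have sylRK := pHall_subl sRK sKE sylR.
  by rewrite (normal_Hall_pcore sylRK nsRK).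
(* The principal character has multiplicity 1 in 'Ind[E, K] 1. *)
have -> : 1 = 'Ind[E, K] 1
    - \sum_(i | i != 0) '['Ind[E, K] 1, 'chi_i] *: 'chi_i :> 'CF(E).
  rewrite {1}['Ind[E, K] 1]cfun_sum_cfdot (bigD1 0) //= addrK irr0.
  by rewrite -cfdot_Res_r cfRes_cfun1 // cfnorm1 scale1r.
rewrite rpredB ?pclosed_span_Ind1 // rpred_sum // => i nz_i.
have [-> | nz_c] := eqVneq '['Ind[E, K] 1, 'chi_i] 0.
  by rewrite scale0r rpred0.
have /natrP[c ->] : '['Ind[E, K] 1, 'chi_i] \in Num.nat.
  by rewrite Cnat_cfdot_char_irr ?cfInd_char ?cfun1_char.
rewrite scaler_nat rpredMn //.
have [j Cj] := constt_cfRes_irr C i.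
pose T := 'I_E['chi_j]%G.
have sTE : T \subset E := subsetIl _ _.
have sCT : C \subset T by apply: sub_Inertia.
have [_ _ imI _ _] := constt_Inertia_bijection j nsCE.
have : i \in irr_constt ('Ind[E] 'chi_j) by rewrite constt_Ind_Res.
rewrite -imI => /imsetP[s As ->].
have [irrI _ _ _ _] := constt_Inertia_bijection j nsCE.
rewrite cfIirrE ?irrI //; apply: pclosed_span_ind => //.
apply: pclosed_span_full; last exact: irr_vchar.
have defT : C ><| (R :&: T) = T by rewrite (sdprod_modl defE) // (setIidPr sTE).
apply: (IHn _ _ _ defT cCC p'C (pgroupS (subsetIl _ _) pR)).
rewrite -ltnS (leq_trans _ leEn) // ltnS proper_card // properEneq sTE andbT.
apply: contra_neq nz_i => defTE.
apply: (invariant_constt_cent_eq0 defE cCC coCR sKE sZK sRK _ Cj) => //.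
by rewrite -[gval E]defTE subsetIr.
Qed.

End Brauer.

(** * Permutation characters prime to q *)

Section Solomon.

Variable gT : finGroupType.
Implicit Types (G H E C R : {group gT}).

Lemma mem_afix_rcoset E (A : {set gT}) g :
  ((E :* g)%g \in 'Fix_('Rs)(A)) = (A \subset E :^ g).
Proof.
apply/afixP/subsetP => [fixA x Ax | sAE x Ax].
  have := fixA x Ax; rewrite /= rcosetE -rcosetM => /rcoset_eqP.
  by rewrite mem_rcoset mem_conjg conjgE invgK mulgA.
rewrite /= rcosetE -rcosetM; apply/rcoset_eqP.
by have := sAE x Ax; rewrite mem_rcoset mem_conjg conjgE invgK mulgA.
Qed.

Lemma cfInd1_card_fix G E x :
    E \subset G -> x \in G ->
  'Ind[G, E] 1 x = #|'Fix_(rcosets E G | 'Rs)[x]|%:R.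
Proof.
move=> sEG Gx; rewrite cfIndE //; apply: canLR (mulKf (neq0CG E)) _.
rewrite -natrM mulnC.
transitivity (#|[set y in G | (x ^ y)%g \in E]|%:R : algC).
  rewrite -sum1_card natr_sum [LHS]big_mkcond [RHS]big_mkcond /=.
  by apply: eq_bigr => y _; rewrite inE cfun1E; case: (y \in G); case: (_ \in E).
congr _%:R; rewrite -(card_imset _ (@invg_inj gT)).
rewrite [imset _ _](_ : _ = cover 'Fix_(rcosets E G | 'Rs)[x]).
  have /and3P[_ tiG _] := rcosets_partition sEG.
  have tiF : trivIset 'Fix_(rcosets E G | 'Rs)[x] by apply: (trivIsetS (subsetIl _ _) tiG).
  rewrite -(eqnP tiF) -sum_nat_const; apply: eq_bigr => D.
  by case/setIP=> /rcosetsP[g _ ->] _; rewrite card_rcoset.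
apply/setP=> y; apply/imsetP/bigcupP => [[g] | [_ /setIP[/rcosetsP[g Gg ->] fixg]]].
  rewrite inE => /andP[Gg Exg] ->; exists (E :* g^-1)%g.
    rewrite inE mem_rcosets (subsetP (mulG_subr E G)) ?groupV //=.
    by rewrite mem_afix_rcoset sub1set mem_conjgV.
  exact: rcoset_refl.
move=> Egy; exists y^-1%g; rewrite ?invgK // inE groupV.
have -> : y \in G.
  by case/rcosetP: Egy => e Ee ->; rewrite groupM // (subsetP sEG).
by rewrite -(rcoset_eqP Egy) mem_afix_rcoset sub1set mem_conjg in fixg.
Qed.

(** Every fixed point of x is fixed by C.  The fixed points of C are the cosets
    in 'N_G(C), since C is the only subgroup of its order in E; their number
    |'N_G(C) : E| is prime to q because E contains the Sylow subgroup R.  The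
    q-part of x acts on them, and fixes as many of them modulo q. *)
Lemma quasi_elementary_fix_mod G E C R (q : nat) x :
    prime q -> x \in G -> C :=: <[x.`_q^']> -> C ><| R = E ->
    q.-Sylow('N_G(C)) R ->
  ~~ (q %| #|'Fix_(rcosets E G | 'Rs)[x]|)%N.
Proof.
move=> q_pr Gx defC defE sylR.
have [nsCE sRE mulCR _ _] := sdprod_context defE.
have [sCE _] := andP nsCE.
have sCG : C \subset G by rewrite defC cycle_subG groupX.
have sRN := pHall_sub sylR.
have sEN : E \subset 'N_G(C).
  by rewrite -mulCR mul_subG // subsetI sCG normG.
have sEG : E \subset G := subset_trans sEN (subsetIl _ _).
have q'C : q^'.-group C by rewrite defC; apply: p_elt_constt.
have qR := pHall_pgroup sylR.
have hallC : q^'.-Hall(E) C.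
  by rewrite /pHall sCE q'C -divgS // -(sdprod_card defE) mulKn ?cardG_gt0 // pnatNK.
pose S := 'Fix_(rcosets E G | 'Rs)(C).
have defS : S = rcosets E 'N_G(C).
  apply/setP=> D; apply/setIP/rcosetsP => [[/rcosetsP[g Gg ->]] | [g /setIP[Gg nCg] ->]].
    rewrite mem_afix_rcoset => sCEg; exists g => //.
    rewrite inE Gg -groupV; apply/normP/eqP.
    rewrite eqEcard cardJg leqnn andbT.
    rewrite (sub_normal_Hall hallC nsCE) ?sub_conjgV //.
    by rewrite pgroupJ.
  split; first by apply/rcosetsP; exists g.
  by rewrite mem_afix_rcoset -(normP nCg) conjSg.
have Q'S : ~~ (q %| #|S|)%N.
  rewrite defS -/#|'N_G(C) : E| -p'natE //.
  by case/and3P: sylR => _ _; apply: pnat_dvd; rewrite indexgS.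
have defx : <[x]> = <<C :|: <[x.`_q]> >>.
  apply/eqP; rewrite eqEsubset [X in _ && X]gen_subG subUset defC.
  rewrite !cycle_subG !cycle_constt !andbT -{1}(consttC q x).
  by rewrite groupM // mem_gen // inE cycle_id ?orbT.
have fixS : 'Fix_(S | 'Rs)(<[x.`_q]>) = 'Fix_(rcosets E G | 'Rs)[x].
  by rewrite -afix_cycle defx afix_gen afixU setIA.
have actS : [acts <[x.`_q]>, on S | 'Rs].
  have cC : <[x.`_q]> \subset 'C(C).
    by rewrite defC cent_cycle cycle_subG; apply/cent1P/commuteX2.
  apply: actsI; last by rewrite acts_fix_norm ?cents_norm.
  by apply: subset_trans (actsRs_rcosets E G); rewrite cycle_subG groupX.
apply: contra Q'S; rewrite -fixS => dvq.
have qQ : q.-group <[x.`_q]> by apply: p_elt_constt.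
by rewrite /dvdn (pgroup_fix_mod qQ actS).
Qed.

(** The integers attained on J form an ideal of the ring of integers that lies
    in no (q).  The proof is Euclid's algorithm: a positive value m > 1 is
    replaced by the remainder modulo m of a value prime to a prime divisor of
    m. *)
Lemma exists_value1 (V : zmodType) (J : zmodClosed V) (ev : {additive V -> algC}) :
    (forall q, prime q -> exists2 f, f \in J & exists2 n : nat, ev f = n%:R & ~~ (q %| n)%N) ->
  exists2 f, f \in J & ev f = 1.
Proof.
move=> Jq; have [f0 Jf0 [m evf0 m2]] := Jq 2 isT.
have: (0 < m)%N by case: m m2 {evf0}.
move: m f0 Jf0 evf0 {m2}; elim/ltn_ind => m IHm f Jf evf m_gt0.
have [m1 | /pdiv_prime q_pr] := leqP m 1; first by exists f; rewrite // evf (@anti_leq m 1) ?m1.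
have [g Jg [n evg q'n]] := Jq _ q_pr.
apply: (IHm (n %% m)%N _ (g - f *+ (n %/ m))); first by rewrite ltn_pmod.
- by rewrite rpredB ?rpredMn.
- rewrite raddfB raddfMn evf evg {1}(divn_eq n m) natrD mulnC natrM.
  by rewrite -[X in _ - X]mulr_natr addrC addKr.
rewrite lt0n; apply: contra q'n => mn; exact: dvdn_trans (pdiv_dvd m) mn.
Qed.

(** If f x = 1 for a member f of J depending on x, the product of all 1 - f
    vanishes on G; expanding it expresses 1 as a member of J. *)
Lemma one_mem_of_value1 G (J : zmodClosed 'CF(G)) :
    {in J &, forall f g, f * g \in J} ->
    {in G, forall x, exists2 f : 'CF(G), f \in J & f x = 1} ->
  1 \in J.
Proof.
move=> JM Jx.
have [f Jf f1] : exists2 f, f \in J & {in enum G, forall x, f x = 1}.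
  have : {subset enum G <= G} by move=> x; rewrite mem_enum.
  elim: (enum G) => [_ | x s IHs sG]; first by exists 0; rewrite ?rpred0.
  have [|f Jf f1] := IHs; first by move=> y sy; rewrite sG // inE sy orbT.
  have [g Jg gx] := Jx x (sG x (mem_head x s)).
  (* 1 - (f + g - f * g) = (1 - f) * (1 - g) *)
  exists (f + g - f * g); first by rewrite rpredB ?rpredD ?JM.
  move=> y; rewrite !cfunE inE => /predU1P[-> | /f1 ->].
    by rewrite gx mulr1 addrC addKr.
  by rewrite mul1r addrK.
by rewrite -(_ : f = 1) //; apply/cfun_inP=> x Gx; rewrite f1 ?mem_enum // cfun1E Gx.
Qed.

End Solomon.

(** For each x and each prime q, Solomon's q-quasi-elementary group E gives a
    permutation character whose value at x is prime to q.  When q differs from p,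
    the Sylow p-subgroup of E lies in the cyclic group C, so E is p-closed; when
    q = p, the Clifford argument reduces E to p-closed subgroups. *)
Theorem vchar_pclosed_span (gT : finGroupType) p (G : {group gT}) (chi : 'CF(G)) :
  prime p -> chi \in 'Z[irr G] -> chi \in zspan (@induced_from_pclosed gT p G).
Proof.
move=> p_pr; apply: pclosed_span_full.
apply: one_mem_of_value1 => [f g Jf Jg | x Gx].
  by apply: pclosed_span_mul => //; apply: pclosed_span_vchar Jg.
have evB : zmod_morphism (fun f : 'CF(G) => f x) by move=> f g; rewrite !cfunE.
pose ev_add := GRing.isZmodMorphism.Build _ _ _ evB.
pose ev : {additive 'CF(G) -> algC} := HB.pack (fun f : 'CF(G) => f x) ev_add.
apply: (exists_value1 (ev := ev)) => q q_pr.
pose C := <[x.`_q^']>%G.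
have [R sylR] := Sylow_exists q 'N_G(C).
have sRN := pHall_sub sylR.
have [[sRG nCR] qR] := (subsetIP sRN, pHall_pgroup sylR).
have sCG : C \subset G by rewrite cycle_subG groupX.
have q'C : q^'.-group C by apply: p_elt_constt.
have tiCR : C :&: R = 1%g by rewrite setIC coprime_TIg // (pnat_coprime qR).
have defE : C ><| R = (C <*> R)%G by rewrite sdprodEY.
pose E := (C <*> R)%G; rewrite -/E in defE.
have sEG : E \subset G by rewrite join_subG sCG.
exists ('Ind[G, E] 1); last first.
  exists #|'Fix_(rcosets E G | 'Rs)[x]|; first exact: cfInd1_card_fix.
  exact: quasi_elementary_fix_mod q_pr Gx _ defE sylR.
have abelC : abelian C by apply: cycle_abelian.
have [Dq | q'p] := eqVneq q p.
  rewrite {q q_pr}Dq in C q'C sylR qR abelC sCG nCR tiCR E sRN defE sEG *.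
  by apply/pclosed_span_ind/(quasi_pclosed_span1 defE).
apply: pclosed_span_Ind1 => //.
have nsCE : C <| E by case/sdprod_context: defE.
have sylO : p.-Sylow(E) 'O_p(C).
  have [sOC pO p'O] := and3P (nilpotent_pcore_Hall p (abelian_nil abelC)).
  have sCE := normal_sub nsCE.
  rewrite /pHall (subset_trans sOC sCE) pO -(Lagrange_index sCE sOC) pnatM p'O.
  rewrite andbT -divgS // -(sdprod_card defE) mulKn ?cardG_gt0 //.
  by apply: (pi_pnat qR); rewrite !inE.
have nsO : 'O_p(C) <| E := char_normal_trans (pcore_char p C) nsCE.
by rewrite (normal_Hall_pcore sylO nsO).
Qed.

(** * The intersection set *)

Section Local.

Variables (gT : finGroupType) (p : nat) (G P H : {group gT}).
Hypotheses (sylP : p.-Sylow(G) P) (sHG : H \subset G) (sNH : 'N_G(P) \subset H).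
Implicit Types L M Q R : {group gT}.

Local Notation S := (intersection_set G P H).

Lemma Sylow_setI_pgroup M R :
  p.-Sylow(M) R -> R \subset P -> p.-Sylow(M) (M :&: P).
Proof.
move=> sylR sRP; have sRMP : R \subset M :&: P.
  by rewrite subsetI (pHall_sub sylR).
have pMP : p.-group (M :&: P) := pgroupS (subsetIr _ _) (pHall_pgroup sylP).
by rewrite (sub_pHall sylR pMP sRMP (subsetIl _ _)).
Qed.

Lemma mem_intersection_set Q t :
  t \in G -> t \notin H -> Q \subset P -> Q \subset P :^ t^-1 -> Q \in S.
Proof.
move=> Gt H't sQP sQPt; rewrite inE sQP; apply/exists_inP; exists t => //.
by rewrite inE H't.
Qed.

Lemma subset_Sylow_overgroup : P \subset H.
Proof.
by apply: subset_trans sNH; rewrite subsetI (pHall_sub sylP) normG.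
Qed.

(** A left factor h in H conjugates H :&: g L g^-1 inside H, which moves its
    Sylow subgroup into P, as P is Sylow in H.  A right factor l in L does not
    change this intersection, but moves the Sylow subgroup L :&: P of L to one
    that covers the Sylow subgroup of the intersection. *)
Lemma dcoset_Sylow_rep L g :
    L \subset G -> p.-Sylow(L) (L :&: P) -> g \in G ->
  exists h l, let y := (h * g)%g in let M := (H :&: L :^ y^-1)%G in
    [/\ h \in H, l \in L, p.-Sylow(M) (M :&: P)
      & M :&: P \subset (L :&: P) :^ (y * l)^-1].
Proof.
move=> sLG sylLP Gg.
have sylPH := pHall_subl subset_Sylow_overgroup sHG sylP.
pose M0 := (H :&: L :^ g^-1)%G.
have [R0 sylR0] := Sylow_exists p M0.
have sR0H : R0 \subset H := subset_trans (pHall_sub sylR0) (subsetIl _ _).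
have [k Hk sR0P] := Sylow_Jsub sylPH sR0H (pHall_pgroup sylR0).
pose y := (k^-1 * g)%g; pose M := (H :&: L :^ y^-1)%G.
have defM : M0 :^ k = M.
  by rewrite /= conjIg (conjGid Hk) -conjsgM /y invMg invgK.
have sylMP : p.-Sylow(M) (M :&: P).
  by apply: Sylow_setI_pgroup sR0P; rewrite -defM pHallJ2.
have sylLPy : p.-Sylow(L :^ y^-1) ((L :&: P) :^ y^-1) by rewrite pHallJ2.
have sMPL : M :&: P \subset L :^ y^-1 by rewrite /= setIAC subsetIr.
have [u Lu sMPu] := Sylow_subJ sylLPy sMPL (pHall_pgroup sylMP).
(* u is in y L y^-1, and u ^ y is the corresponding element of L. *)
exists k^-1%g, (u ^ y)^-1%g; split => //; rewrite ?groupV // -/y.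
  by rewrite mem_conjg invgK in Lu.
have conjV (v w : gT) : ((v * (w ^ v)^-1)^-1 = v^-1 * w)%g.
  by rewrite invMg invgK conjgE !mulgA mulgK.
by rewrite conjV conjsgM.
Qed.

(** The Sylow subgroup Q of the intersection lies in P and in the conjugate of
    L :&: P by some y = h g l.  If y is outside H, then Q is in S.  If y is in
    H, then g is in H when L is, so L :&: P must be in S: it lies in t P t^-1
    for some t outside H, and then y t is outside H and conjugates P to a
    subgroup containing Q. *)
Lemma dcoset_in_calI L (phi : vchar L) g :
    L \subset G -> p.-Sylow(L) (L :&: P) -> g \in G ->
    (L :&: P)%G \in S \/ L \subset H /\ g \notin H ->
  exists2 y, y \in dcoset H L g & vMackey H phi y \in calI p H P S.
Proof.
move=> sLG sylLP Gg dichotomy.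
have [h [l /= [Hh Ll sylMP sMPL]]] := dcoset_Sylow_rep sLG sylLP Gg.
exists (h * g)%g; first by apply/dcosetP; exists h => //; exists 1%g; rewrite ?mulg1.
pose M := (H :&: L :^ (h * g)^-1)%G.
apply: zspan_gen; exists M, (vRes M (vConj (h * g) phi)).
split=> //; first exact: subsetIl.
pose y := (h * g * l)%g.
have Gy : y \in G by rewrite !groupM ?(subsetP sHG h) ?(subsetP sLG l).
have sMP_P : M :&: P \subset P := subsetIr _ _.
have sMP_Py : M :&: P \subset P :^ y^-1.
  by apply: subset_trans sMPL _; rewrite conjSg subsetIr.
have [Hy | H'y] := boolP (y \in H); last exact: mem_intersection_set Gy H'y _ _.
case: dichotomy => [SL | [sLH H'g]]; last first.
  by rewrite /y groupMr ?(subsetP sLH l) // groupMl // (negPf H'g) in Hy.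
move: SL; rewrite inE => /andP[_ /exists_inP[t /setDP[Gt H't] sLPt]].
have Gyt : (y * t)%g \in G by rewrite groupM.
have H'yt : (y * t)%g \notin H by rewrite (groupMl _ Hy).
apply: mem_intersection_set Gyt H'yt sMP_P _.
by rewrite invMg conjsgM (subset_trans sMPL) // conjSg.
Qed.

Lemma vInd_calI psi : psi \in calI p H P S -> vInd G psi \in calI p G P S.
Proof.
move: psi; apply: zspan_ind => [|u v Iu Iv|_ [L [phi [sLH sylL SL ->]]]].
- by rewrite raddf0 rpred0.
- by rewrite raddfB rpredB.
apply: zspan_gen; exists L, phi; rewrite vIndInd //.
by split=> //; apply: subset_trans sHG.
Qed.

Lemma vRes_calI phi : phi \in calI p G P S -> vRes H phi \in calI p H P S.
Proof.
move: phi; apply: zspan_ind => [|u v Iu Iv|_ [L [phi [sLG sylL SL ->]]]].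
- by rewrite raddf0 rpred0.
- by rewrite raddfB rpredB.
have /choice[r Dr] (D : {set gT}) : exists y, D \in dcoset H L @: G ->
    y \in D /\ vMackey H phi y \in calI p H P S.
  have [/imsetP[g Gg ->] | _] := boolP (D \in _); last by exists 1%g.
  by have [y] := dcoset_in_calI phi sLG sylL Gg (or_introl SL); exists y.
rewrite (vMackeyE _ (r := r)) // => [|D /Dr[] //].
by apply: rpred_sum => D /Dr[].
Qed.

(** The trivial double coset H contributes psi to Mackey's formula, and every
    other one a member of calI. *)
Lemma vRes_vInd_calI psi : vRes H (vInd G psi) - psi \in calI p H P S.
Proof.
have sylH : p.-Sylow(H) (H :&: P).
  by rewrite (setIidPr subset_Sylow_overgroup) (pHall_subl _ sHG sylP) ?subset_Sylow_overgroup.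
have H1 : dcoset H H 1 = H by rewrite /dcoset mulg1 mulGid.
have /choice[r Dr] (D : {set gT}) : exists y, D \in dcoset H H @: G ->
    y \in D /\ if D == H then y = 1%g else vMackey H psi y \in calI p H P S.
  have [/imsetP[g Gg ->] | _] := boolP (D \in _); last by exists 1%g.
  have [-> | neqD] := eqVneq (dcoset H H g) H; first by exists 1%g.
  have H'g : g \notin H.
    by apply: contra neqD => Hg; rewrite -[X in _ == X]H1; apply/eqP/dcoset_eqP; rewrite H1.
  by have [y] := dcoset_in_calI psi sHG sylH Gg (or_intror (conj (subxx H) H'g)); exists y.
rewrite (vMackeyE _ (r := r)) // => [|D /Dr[] //].
have GH : (H : {set gT}) \in dcoset H H @: G by apply/imsetP; exists 1%g.
rewrite (bigD1 (H : {set gT})) //=.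
have [_] := Dr _ GH; rewrite eqxx => ->; rewrite vMackey1 addrAC subrr add0r.
by apply: rpred_sum => D /andP[/Dr[_] + neqD]; rewrite (negPf neqD).
Qed.

(** After conjugation, the normal Sylow p-subgroup Q of L lies in P.  If Q is
    not in S, then every t in L is in H, because Q lies in P and in t P t^-1,
    as Q = t Q t^-1; so phi can first be induced to H. *)
Lemma pclosed_vInd_mod_calI L (phi : vchar L) :
    L \subset G -> p.-Sylow(L) 'O_p(L) ->
  exists psi : vchar H, vInd G phi - vInd G psi \in calI p G P S.
Proof.
move=> sLG sylL.
have [g Gg sOP] := Sylow_Jsub sylP (subset_trans (pcore_sub p L) sLG) (pcore_pgroup p L).
pose M := (L :^ g^-1^-1)%G; pose phiM : vchar M := vConj g^-1 phi.
have defphi : vInd G phi = vInd G phiM by rewrite vInd_vConj ?groupV.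
have sMG : M \subset G by rewrite /= invgK -(conjGid Gg) conjSg.
have sylO : p.-Sylow(M) 'O_p(M) by rewrite /= invgK pcoreJ pHallJ2.
have sOMP : 'O_p(M) \subset P by rewrite /= invgK pcoreJ.
have sylM := Sylow_setI_pgroup sylO sOMP.
have [SM | S'M] := boolP ((M :&: P)%G \in S).
  exists 0; rewrite raddf0 subr0 defphi; apply: zspan_gen.
  by exists M, phiM.
have nM : M \subset 'N(M :&: P).
  rewrite (sub_pHall sylO (pHall_pgroup sylM) _ (subsetIl _ _)) ?gFnorm //.
  by rewrite subsetI pcore_sub.
have sMH : M \subset H.
  apply/subsetP=> t Mt; apply: contraR S'M => H't.
  apply: (@mem_intersection_set _ t) => //; rewrite ?subsetIr ?(subsetP sMG) //.
  by rewrite -sub_conjg (normP (subsetP nM t Mt)) subsetIr.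
by exists (vInd H phiM); rewrite vIndInd // defphi subrr rpred0.
Qed.

Hypothesis p_pr : prime p.

Lemma vchar_vInd_mod_calI (phi : vchar G) :
  exists psi : vchar H, phi - vInd G psi \in calI p G P S.
Proof.
suffices [psi [theta Itheta Dphi]] : exists psi : vchar H,
    exists2 theta : vchar G, theta \in calI p G P S
      & vchar_val phi = vchar_val (vInd G psi + theta).
  by exists psi; rewrite (val_inj Dphi) addrC addKr.
(* The span lives among class functions, where the property to be propagated
   must therefore be expressed. *)
have := vchar_pclosed_span p_pr (vchar_valP phi); move: (vchar_val phi).
apply: zspan_ind => [|_ _ [u [i Ii ->]] [v [j Ij ->]]|].
- by exists 0; exists 0; rewrite ?rpred0 // raddf0 addr0.
- exists (u - v); exists (i - j); rewrite ?rpredB // raddfB.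
  by rewrite addrACA -opprD.
move=> _ [E [xi [sEG sylE Zxi ->]]].
have [psi Ipsi] := pclosed_vInd_mod_calI (VChar Zxi) sEG sylE.
exists psi; exists (vInd G (VChar Zxi) - vInd G psi) => //.
by rewrite addrC subrK.
Qed.

(** Formal, given that vInd from H is surjective modulo calI and that vRes is a
    left inverse to it: phi is congruent to some vInd G psi, which vRes sends to
    psi modulo calI. *)
Lemma vInd_vRes_calI (phi : vchar G) : vInd G (vRes H phi) - phi \in calI p G P S.
Proof.
have [psi Iphi] := vchar_vInd_mod_calI phi.
have -> : vInd G (vRes H phi) - phi =
    vInd G (vRes H (phi - vInd G psi)) + vInd G (vRes H (vInd G psi) - psi)
      - (phi - vInd G psi).
  by rewrite (raddfB (@vRes gT G H)) !(raddfB (@vInd gT G H)) addrA subrK opprB addrA subrK.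
apply: (rpredB _ Iphi); apply: rpredD; apply: vInd_calI; last exact: vRes_vInd_calI.
exact: vRes_calI.
Qed.

End Local.

Theorem theorem1p4 (gT : finGroupType) (G P H : {group gT}) (p : nat)
    (p_pr : prime p) (sylP : p.-Sylow(G) P)
    (sHG : H \subset G) (sNH : 'N_G(P) \subset H) :
  let S := intersection_set G P H in
  let IG := calI p G P S in
  let IH := calI p H P S in
  [/\ forall psi : vchar H, psi \in IH -> vInd G psi \in IG,
      forall phi : vchar G, phi \in IG -> vRes H phi \in IH
    & exists (res : {additive {ideal_quot IG} -> {ideal_quot IH}})
             (ind : {additive {ideal_quot IH} -> {ideal_quot IG}}),
      [/\ forall phi : vchar G, res (\pi_{ideal_quot IG} phi) = \pi_{ideal_quot IH} (vRes H phi),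
          forall psi : vchar H, ind (\pi_{ideal_quot IH} psi) = \pi_{ideal_quot IG} (vInd G psi),
          cancel res ind
        & cancel ind res]].
Proof.
move=> S IG IH.
have IndI : forall psi : vchar H, psi \in IH -> vInd G psi \in IG.
  exact: vInd_calI.
have ResI : forall phi : vchar G, phi \in IG -> vRes H phi \in IH.
  exact: vRes_calI.
split=> //.
have [res Dres] := quot_additive_lift (@vRes_zmod_morphism gT G H) ResI.
have [ind Dind] := quot_additive_lift (@vInd_zmod_morphism gT G H) IndI.
exists res, ind; split=> // u; rewrite -[u]reprK.
  rewrite Dres Dind; apply/eqP; rewrite -Quotient.idealrBE.
  exact: vInd_vRes_calI.
rewrite Dind Dres; apply/eqP; rewrite -Quotient.idealrBE.
exact: vRes_vInd_calI.
Qed.
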